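(* Fix an integer $k\geq 2$ and let $(\mathcal{R}_n)_{n\geq 0}$ be the $k$-step Narayana numbers, defined by $\mathcal{R}_0=0$, $\mathcal{R}_i=1$ for $1\leq i\leq k-1$, and $\mathcal{R}_n=\mathcal{R}_{n-1}+\mathcal{R}_{n-k}$ for $n\geq k$. Then for every integer $n\geq 0$, \[ \left(k^k+(k-1)^{k-1}\right)\sum_{i=0}^{n}\mathcal{R}_i\mathcal{R}_{n-i} = k^{k-1}(n+k-2)\,\mathcal{R}_{n+k-1} - \sum_{j=0}^{k-2} k^{j}(k-1)^{k-2-j}\,(n+k+j-1)\,\mathcal{R}_{n+j}. \]
   Context: For $k=2$ the sequence $\mathcal{R}_n$ is the Fibonacci sequence. *)

(* Defs.v *)
From mathcomp Require Import all_boot all_order all_algebra.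

Set Implicit Arguments.
Unset Strict Implicit.
Unset Printing Implicit Defensive.

(* The list [:: R_n; R_(n-1); ...; R_0] of the k-step Narayana numbers, latest
   first, so that R_(n+1-k) sits at position k-1. *)
Fixpoint narayana_hist (k n : nat) : seq nat :=
  if n is m.+1 then
    let s := narayana_hist k m in
    (if m.+1 < k then 1 else nth 0 s 0 + nth 0 s k.-1) :: s
  else [:: 0].

Definition narayana (k n : nat) : nat := head 0 (narayana_hist k n).

Lemma nth_narayana_hist k n i :
  i <= n -> nth 0 (narayana_hist k n) i = narayana k (n - i).
Proof.
elim: n i => [|n IHn] [|i] //= le_in; exact: IHn.
Qed.

Lemma narayana0 k : narayana k 0 = 0.
Proof. by []. Qed.

Lemma narayana_init k i : 1 <= i -> i <= k - 1 -> narayana k i = 1.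
Proof.
case: i k => [|i] [|k] //= _; rewrite subSS subn0 => lt_ik.
by rewrite /narayana /= ltnS lt_ik.
Qed.

Lemma narayana_rec k n : 2 <= k -> k <= n ->
  narayana k n = narayana k (n - 1) + narayana k (n - k).
Proof.
case: k n => [|k] [|n] // k_ge2 le_kn.
by rewrite {1}/narayana /= ltnNge le_kn /= !nth_narayana_hist //.
Qed.

(* Main.v *)
Require Import Defs.
From mathcomp Require Import all_boot all_order all_algebra.
From mathcomp Require Import zify ring.
Import GRing.Theory.
Local Open Scope ring_scope.

(** Write [k = p + 2].  Both sides, extended to the indices [n >= - p], satisfy
    [f (m + k) = f (m + k - 1) + f m + c R_(n + k - 1)] with the same constant
    [c = k^k + (k-1)^(k-1)], where [m = n + p], and both vanish for [m < k].  On
    the right-hand side, applying the recurrence operator to [(m + a) R_m] leaves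
    [k R_(m + k) - (k - 1) R_(m + k - 1)], so the sum over [j] telescopes; the
    initial values telescope too. *)

(* Truncated subtraction extends R by zeros: entry [m] is R_(m - p), which is the
   correct backward continuation of the recurrence down to index [- p]. *)
Definition narayana_shift (p m : nat) : int := (narayana p.+2 (m - p))%:Z.

Lemma narayana_shiftD p m : narayana_shift p (m + p) = (narayana p.+2 m)%:Z.
Proof. by rewrite /narayana_shift addnK. Qed.

Lemma narayana_shift_eq0 p m : (m <= p)%N -> narayana_shift p m = 0.
Proof. by rewrite /narayana_shift -subn_eq0 => /eqP ->; rewrite narayana0. Qed.

(** The run of ones reaches one step past the initial values, since R_k = R_(k-1) + R_0 = 1. This
    last index, m = 2p + 2, is needed for the leading term in [narayana_rhs_eq0]. *)
Lemma narayana_shift_eq1 p m :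
  (p < m)%N -> (m <= p.*2.+2)%N -> narayana_shift p m = 1.
Proof.
move=> lt_pm le_m; rewrite /narayana_shift; congr Posz.
have [lt_m|ge_m] := ltnP m p.*2.+2; first by apply: narayana_init; lia.
have -> : (m - p = p.+2)%N by lia.
rewrite narayana_rec // subnn narayana0 addn0.
by apply: narayana_init; lia.
Qed.

Lemma narayana_shift_rec p m :
  narayana_shift p (m + p.+2) = narayana_shift p (m + p.+1) + narayana_shift p m.
Proof.
rewrite /narayana_shift -PoszD; congr Posz.
have -> : (m + p.+2 - p = m.+2)%N by lia.
have -> : (m + p.+1 - p = m.+1)%N by lia.
(* Below p the padding contributes 0, and both R_(m+2) and R_(m+1) are still initial ones. *)
have [lt_mp|le_pm] := ltnP m p.
  have /eqP -> : (m - p == 0)%N by rewrite subn_eq0 ltnW.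
  by rewrite narayana0 addn0 !narayana_init //; lia.
by rewrite narayana_rec //; congr (narayana _ _ + narayana _ _)%N; lia.
Qed.

Lemma linear_rec_eq0 (p : nat) (f : nat -> int) :
    (forall m, (m < p.+2)%N -> f m = 0) ->
    (forall m, f (m + p.+2)%N = f (m + p.+1)%N + f m) ->
  forall m, f m = 0.
Proof.
move=> f0 frec m; elim/ltn_ind: m => m IHm.
have [/f0 //|le_m] := ltnP m p.+2.
by rewrite -(subnK le_m) frec !IHm ?addr0 //; lia.
Qed.

Definition narayana_conv (p m : nat) : int :=
  \sum_(0 <= i < m.+1) narayana_shift p i * (narayana p.+2 (m - i))%:Z.

Lemma narayana_convD p n :
  narayana_conv p (n + p) =
  \sum_(0 <= i < n.+1) (narayana p.+2 i)%:Z * (narayana p.+2 (n - i))%:Z.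
Proof.
rewrite /narayana_conv (@big_cat_nat _ _ _ p) ?leq0n //=; last by lia.
rewrite big_nat_cond big1 ?add0r; last first.
  by move=> i /andP[/andP[_ lt_ip] _]; rewrite narayana_shift_eq0 ?mul0r // ltnW.
rewrite -{1}[p]add0n big_addn.
have -> : ((n + p).+1 - p = n.+1)%N by lia.
apply: eq_big_nat => i /andP[_ lt_in].
by rewrite narayana_shiftD; congr (_ * (narayana _ _)%:Z); lia.
Qed.

Lemma narayana_conv_eq0 p m : (m < p.+2)%N -> narayana_conv p m = 0.
Proof.
move=> lt_m; rewrite /narayana_conv big_nat_cond big1 // => i.
move=> /andP[/andP[_ lt_im] _]; have [le_ip|lt_pi] := leqP i p.
  by rewrite narayana_shift_eq0 // mul0r.
have -> : (m - i = 0)%N by lia.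
by rewrite narayana0 mulr0.
Qed.

(** Only the shifted factor is advanced. Its recurrence handles the tail of each split sum; of the
    heads, only the term i = p + 1 at m + p + 2 survives, and it equals R_(m+1). *)
Lemma narayana_conv_rec p m :
  narayana_conv p (m + p.+2) =
  narayana_conv p (m + p.+1) + narayana_conv p m + narayana_shift p (m + p.+1).
Proof.
have split_conv l : narayana_conv p (m + l) =
    \sum_(0 <= i < l) narayana_shift p i * (narayana p.+2 (m + l - i))%:Z
    + \sum_(0 <= i < m.+1) narayana_shift p (i + l) * (narayana p.+2 (m - i))%:Z.
  rewrite /narayana_conv (@big_cat_nat _ _ _ l) ?leq0n //=; last by lia.
  congr (_ + _); rewrite -{1}[l]add0n big_addn.
  have -> : ((m + l).+1 - l = m.+1)%N by lia.
  apply: eq_big_nat => i /andP[_ lt_im].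
  by congr (_ * (narayana _ _)%:Z); lia.
have init0 l : \sum_(0 <= i < p.+1)
    narayana_shift p i * (narayana p.+2 (l - i))%:Z = 0.
  rewrite big_nat_cond big1 // => i /andP[/andP[_ lt_ip] _].
  by rewrite narayana_shift_eq0 ?mul0r.
rewrite !split_conv big_nat_recr //= !init0 !add0r.
rewrite narayana_shift_eq1 ?mul1r //; last by lia.
rewrite [RHS]addrC; congr (_ + _).
  by rewrite /narayana_shift; congr (narayana _ _)%:Z; lia.
rewrite /narayana_conv -big_split /=.
by apply: eq_bigr => i _; rewrite narayana_shift_rec mulrDl.
Qed.

(** With m = n + k - 2, the factors n + k - 2 and n + k + j - 1 become m and m + j + 1. *)
Definition narayana_rhs (p m : nat) : int :=
  p.+2%:Z ^+ p.+1 * m%:Z * narayana_shift p (m + p.+1)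
  - \sum_(0 <= j < p.+1) p.+2%:Z ^+ j * p.+1%:Z ^+ (p - j)
      * (m + j).+1%:Z * narayana_shift p (m + j).

Lemma narayana_rhs_eq0 p m : (m < p.+2)%N -> narayana_rhs p m = 0.
Proof.
move=> lt_m; rewrite /narayana_rhs.
have [->|m_gt0] := posnP m.
  rewrite mulr0 mul0r sub0r big_nat_cond big1 ?oppr0 // => j.
  by move=> /andP[/andP[_ lt_jp] _]; rewrite narayana_shift_eq0 ?mulr0.
rewrite narayana_shift_eq1 ?mulr1; [|lia..].
rewrite (@big_cat_nat _ _ _ (p.+1 - m)) ?leq0n ?leq_subr //=.
rewrite big_nat_cond big1 ?add0r; last first.
  by move=> j /andP[/andP[_ lt_j] _]; rewrite narayana_shift_eq0 ?mulr0 //; lia.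
(* On the remaining range R is 1, and [b] is a discrete antiderivative of the summand. It vanishes
   at j = p + 1 - m, and its value at p + 1 cancels the leading term. *)
pose b j : int :=
  p.+2%:Z ^+ j * p.+1%:Z ^+ (p.+1 - j) * (j%:Z + m%:Z - p.+1%:Z).
rewrite (eq_big_nat _ _ (F2 := fun j => b j.+1 - b j)); last first.
  move=> j /andP[le_j lt_j]; rewrite narayana_shift_eq1 ?mulr1; [|lia..].
  rewrite /b subSS (subSn (_ : j <= p)%N) // !exprS.
  by ring.
rewrite telescope_sumr ?leq_subr // /b subnn expr0.
have -> : (p.+1 - m)%N%:Z + m%:Z - p.+1%:Z = 0 by lia.
by ring.
Qed.

Lemma narayana_rhs_rec p m :
  narayana_rhs p (m + p.+2) =
  narayana_rhs p (m + p.+1) + narayana_rhs p m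
  + (p.+2%:Z ^+ p.+2 + p.+1%:Z ^+ p.+1) * narayana_shift p (m + p.+1).
Proof.
pose u := narayana_shift p.
have urec l : u (l + p.+2)%N = u (l + p.+1)%N + u l by exact: narayana_shift_rec.
(* The weights k^j (k-1)^(p-j) turn each leftover k R - (k-1) R into [a j.+1 - a j]. The end
   [a p.+1] cancels against the leading term, and [a 0] supplies the summand (k-1)^(k-1) of the
   constant. *)
pose a j : int := p.+2%:Z ^+ j * p.+1%:Z ^+ (p.+1 - j) * u (m + p.+1 + j)%N.
have sum_rec :
    \sum_(0 <= j < p.+1) p.+2%:Z ^+ j * p.+1%:Z ^+ (p - j)
      * (m + p.+2 + j).+1%:Z * u (m + p.+2 + j)%N =
    \sum_(0 <= j < p.+1) p.+2%:Z ^+ j * p.+1%:Z ^+ (p - j)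
      * (m + p.+1 + j).+1%:Z * u (m + p.+1 + j)%N
    + \sum_(0 <= j < p.+1) p.+2%:Z ^+ j * p.+1%:Z ^+ (p - j)
      * (m + j).+1%:Z * u (m + j)%N
    + (a p.+1 - a 0%N).
  rewrite -(telescope_sumr a (leq0n p.+1)) -!big_split /=.
  apply: eq_big_nat => j /andP[_ lt_j].
  rewrite /a subSS (subSn (_ : j <= p)%N) // !exprS.
  have -> : (m + p.+1 + j.+1 = m + j + p.+2)%N by lia.
  have -> : (m + p.+2 + j = m + j + p.+2)%N by lia.
  have -> : (m + p.+1 + j = m + j + p.+1)%N by lia.
  by rewrite urec; ring.
rewrite /narayana_rhs -/u sum_rec /a subnn subn0 addn0 expr0.
have -> : (m + p.+2 + p.+1 = m + p.+1 + p.+2)%N by lia.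
by rewrite urec !exprS; ring.
Qed.

Lemma narayana_conv_rhs p m :
  (p.+2%:Z ^+ p.+2 + p.+1%:Z ^+ p.+1) * narayana_conv p m = narayana_rhs p m.
Proof.
apply/eqP; rewrite -subr_eq0; apply/eqP; move: m.
(* The inhomogeneous terms agree, so the difference satisfies the homogeneous recurrence. *)
apply: (@linear_rec_eq0 p) => m => [lt_m|].
  by rewrite narayana_conv_eq0 // narayana_rhs_eq0 // mulr0 subrr.
by rewrite narayana_conv_rec narayana_rhs_rec; ring.
Qed.

Theorem theorem4p1 (k : nat) (hk : (2 <= k)%N) (n : nat) :
  (k%:Z ^+ k + (k%:Z - 1) ^+ (k - 1)) *
    (\sum_(0 <= i < n.+1) (narayana k i)%:Z * (narayana k (n - i))%:Z)
  = k%:Z ^+ (k - 1) * (n%:Z + k%:Z - 2) * (narayana k (n + k - 1))%:Z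
    - \sum_(0 <= j < k - 1)
        k%:Z ^+ j * (k%:Z - 1) ^+ (k - 2 - j) * (n%:Z + k%:Z + j%:Z - 1)
          * (narayana k (n + j))%:Z.
Proof.
case: k hk => [|[|p]] // _.
have -> : p.+2%:Z - 1 = p.+1%:Z by lia.
have -> : (p.+2 - 1 = p.+1)%N by lia.
have -> : (p.+2 - 2 = p)%N by lia.
have -> : (n + p.+2 - 1 = n + p.+1)%N by lia.
rewrite -narayana_convD narayana_conv_rhs /narayana_rhs; congr (_ - _).
  have -> : (n + p + p.+1 = n + p.+1 + p)%N by lia.
  by rewrite narayana_shiftD; congr (_ * _ * _); lia.
apply: eq_bigr => j _.
rewrite (_ : n + p + j = n + j + p)%N; last by lia.
by rewrite narayana_shiftD; congr (_ * _ * _); lia.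
Qed.
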